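(* Let $m\geq 2$ be an integer and let $\Phi:\mathbb{N}\to(0,1)$ satisfy $(d1)$, $(d2)$, $(d3)$. Then there exist uncountably many $\underline{\xi}\in\mathbb{R}^m$ for which the following claims all hold: (C1) There is $Q_0$ such that $\psi_{\underline{\xi}}(Q)<\Phi(Q)$ for all integers $Q\geq Q_0$. (C2) For any $\varepsilon>0$, we have $\psi_{\underline{\xi}}(Q)>(1-\varepsilon)\Phi(Q)$ for certain arbitrarily large integers $Q$. (C3) For every $N$, $\liminf_{Q\to\infty}Q^{N}\psi_{\underline{\xi}}(Q)=0$. If moreover for some $\gamma>0$ the function $\Phi$ satisfies $(d4(\gamma))$, then the packing dimension of the set of $\underline{\xi}\in\mathbb{R}^m$ satisfying (C1), (C2), (C3) is at least $m(1-\gamma)$.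
   Context: For $x\in\mathbb{R}$ let $\Vert x\Vert$ be the distance of $x$ to the nearest integer, and for $\underline{x}\in\mathbb{R}^m$ let $\Vert\underline{x}\Vert=\max_{1\leq i\leq m}\Vert x_i\Vert$. For $\underline{\xi}\in\mathbb{R}^m$ and $Q\geq 1$ let $\psi_{\underline{\xi}}(Q)=\min_{1\leq q\leq Q}\Vert q\underline{\xi}\Vert$, where $q$ ranges over the positive integers up to $Q$. For a fixed integer $m\ge 2$ and a function $\Phi:\mathbb{N}\to(0,1)$ (not assumed monotone) define: $(d1)$: there is $t_0$ with $\Phi(t)<t^{-1/m}$ for all $t\geq t_0$. $(d2)$: $\lim_{t\to\infty}t^{\frac{1}{m-1}}\Phi(t)=\infty$. $(d3)$: $\liminf_{\alpha\to1^{+}}\liminf_{t\to\infty}\frac{\Phi(\alpha t)}{\Phi(t)}\geq 1$ if $m\geq 3$, and $\liminf_{\alpha\to1}\liminf_{t\to\infty}\frac{\Phi(\alpha t)}{\Phi(t)}\geq 1$ if $m=2$, where $t$ and $\alpha t$ are integers. This is understood in the following sense: for every $\epsilon_0>0$ there are $\epsilon_1>0$ and $t_0>0$ such that for all $\alpha\in(1,1+\epsilon_1)$ (respectively all $\alpha\in(1-\epsilon_1,1+\epsilon_1)$ when $m=2$) and all $t\geq t_0$ with $t,\alpha t$ integers we have $\frac{\Phi(\alpha t)}{\Phi(t)}\geq 1-\epsilon_0$. $(d4(\gamma))$, for given $\gamma>0$: there are $\eta>0$ and $t_0$ with $\Phi(t)>\eta t^{-\gamma}$ for all $t\geq t_0$.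 *)

(* Defs.v *)
From HB Require Import structures.
From mathcomp Require Import all_boot all_order all_algebra.
From mathcomp Require Import all_classical all_reals all_analysis.
Set Implicit Arguments.
Unset Strict Implicit.
Unset Printing Implicit Defensive.
Import Order.TTheory GRing.Theory Num.Theory.
Import numFieldNormedType.Exports.
Local Open Scope classical_set_scope.
Local Open Scope ring_scope.

(** ** Diophantine approximation *)

Definition dist_int (R : realType) (x : R) : R :=
  inf [set `|x - n%:~R| | n in [set: int]].

(* The base value 0 of the maximum is harmless, [dist_int] being nonnegative. *)
Definition dist_int_vec (R : realType) (m : nat) (x : 'rV[R]_m) : R :=
  \big[Num.max/0]_(i < m) dist_int (x ord0 i).

(* [Q] is real; for [1 <= Q] this is the infimum of a finite nonempty set, hence
   a minimum. *)
Definition psi (R : realType) (m : nat) (xi : 'rV[R]_m) (Q : R) : R :=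
  inf [set dist_int_vec (q%:R *: xi) | q in [set q : nat | (0 < q)%N /\ q%:R <= Q]].

(** ** Conditions on the approximation function *)

(* A map from the positive integers to (0, 1); the value at 0 is irrelevant. *)
Definition maps_to_01 (R : realType) (Phi : nat -> R) : Prop :=
  forall t : nat, (0 < t)%N -> 0 < Phi t < 1.

Definition cond_d1 (R : realType) (m : nat) (Phi : nat -> R) : Prop :=
  exists t0 : nat, forall t : nat, (t0 <= t)%N ->
    Phi t < t%:R `^ (- (m%:R^-1)).

Definition cond_d2 (R : realType) (m : nat) (Phi : nat -> R) : Prop :=
  (fun t : nat => t%:R `^ ((m%:R - 1)^-1) * Phi t) @ \oo --> +oo.

(* [t] and [s = alpha * t] are the two integers at which [Phi] is evaluated. The
   range of [alpha] is one-sided for [m >= 3] and two-sided for [m = 2]. *)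
Definition cond_d3 (R : realType) (m : nat) (Phi : nat -> R) : Prop :=
  forall eps0 : R, 0 < eps0 ->
    exists (eps1 : R) (t0 : nat), [/\ 0 < eps1, (0 < t0)%N &
      forall (alpha : R) (t s : nat),
        (if m == 2%N then 1 - eps1 else 1) < alpha < 1 + eps1 ->
        (t0 <= t)%N -> (0 < s)%N -> s%:R = alpha * t%:R ->
        1 - eps0 <= Phi s / Phi t].

Definition cond_d4 (R : realType) (gamma : R) (Phi : nat -> R) : Prop :=
  exists (eta : R) (t0 : nat), 0 < eta /\
    forall t : nat, (t0 <= t)%N -> eta * t%:R `^ (- gamma) < Phi t.

(** ** The three claims *)

Definition claim_C1 (R : realType) (m : nat) (Phi : nat -> R) (xi : 'rV[R]_m) :
    Prop :=
  exists Q0 : nat, forall Q : nat, (Q0 <= Q)%N -> psi xi Q%:R < Phi Q.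

Definition claim_C2 (R : realType) (m : nat) (Phi : nat -> R) (xi : 'rV[R]_m) :
    Prop :=
  forall eps : R, 0 < eps -> forall Q1 : nat,
    exists2 Q : nat, (Q1 <= Q)%N & (1 - eps) * Phi Q < psi xi Q%:R.

Definition claim_C3 (R : realType) (m : nat) (xi : 'rV[R]_m) : Prop :=
  forall N : nat,
    limf_einf (fun Q : R => (Q ^+ N * psi xi Q)%:E) (pinfty_nbhs R) = 0%E.

Definition solutions (R : realType) (m : nat) (Phi : nat -> R) :
    set 'rV[R]_m :=
  [set xi | [/\ claim_C1 Phi xi, claim_C2 Phi xi & claim_C3 xi]].

(** ** Packing measure and packing dimension *)

Section packing.
Context (R : realType) (V : normedModType R).
Local Open Scope ereal_scope.

(* A packing is coded by the set [D] of its pairs (centre, radius). *)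
Definition is_packing (delta : R) (F : set V) (D : set (V * R)) : Prop :=
  [/\ countable D,
      forall p, D p -> F p.1 /\ (0 < p.2 <= delta)%R &
      trivIset D (fun p => closed_ball p.1 p.2)].

(* A ball of radius r contributes its diameter 2r to the power s. *)
Definition packing_premeasure_delta (s delta : R) (F : set V) : \bar R :=
  ereal_sup [set \esum_(p in D) ((2 * p.2) `^ s)%:E | D in is_packing delta F].

(* The limit as delta tends to 0+, which by monotonicity is an infimum. *)
Definition packing_premeasure (s : R) (F : set V) : \bar R :=
  ereal_inf [set packing_premeasure_delta s delta F
            | delta in [set delta : R | (0 < delta)%R]].

(* The premeasure is not countably subadditive, whence the countable covers. *)
Definition packing_measure (s : R) (F : set V) : \bar R :=
  ereal_inf [set \sum_(0 <= i <oo) packing_premeasure s (E i)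
            | E in [set E : nat -> set V | F `<=` \bigcup_i E i]].

Definition packing_dim (F : set V) : \bar R :=
  ereal_inf [set s%:E | s in [set s : R | (0 <= s)%R /\ packing_measure s F = 0]].

End packing.

(* Main.v *)
Require Import Defs.
From mathcomp Require Import all_boot all_order all_algebra.
From mathcomp Require Import all_classical all_reals all_analysis.
From mathcomp Require Import zify ring lra.
Set Implicit Arguments.
Unset Strict Implicit.
Unset Printing Implicit Defensive.
Import Order.TTheory GRing.Theory Num.Theory.
Import numFieldNormedType.Exports.
Local Open Scope classical_set_scope.
Local Open Scope ring_scope.

(** Both conclusions come from one tree of rational points. A node is a rational
    point p/q, standing for the cube of radius 1/(4q) about it; children of a
    node are chosen so that every point of the cube of a child already satisfies
    (C1) for all Q between the two denominators, (C2) for one Q there, and (C3)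
    for the exponent given by the level. Every infinite branch then converges to
    a solution. By a Baire category argument ([tree_category]), if the solutions
    are covered by countably many sets E_i, some E_i meets the cubes of all
    children of some node. So it is enough that every node has many well
    separated children: two of them make the solutions uncountable, and the
    count in [packing_dim_solutions_ge] forces the premeasure of E_i to be
    infinite.

    A child is reached in two moves.

    The exact move ([exact_step]) secures (C2) and (C3). Let h be a huge multiple
    of q^2, let L be the first Q >= q at which Phi Q is at most about 1/h, and
    let C be the multiple of q^2 for which C h^(m-1) is just below L. By (d1),
    L <= h^m, hence C <= h; by (d2), C is large. Replace p/q by
      w = p/q + (1/(qh), 1/h^2, ..., 1/h^(m-1), 1/(C h^(m-1))),
    a point with denominator q' = C h^(m-1). Then q w is within 1/h of an integer
    point, so the integer q alone makes psi less than Phi until q'. Conversely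
    every positive n < q' has n w at distance almost 1/h at least from the
    integer points ([shift_separation]): the coordinates form a triangular
    system, so that a short vector n w forces h, h^2, ... and finally q' to
    divide n. The factor 1/q in the first coordinate keeps the volume within the
    range allowed by Dirichlet's theorem; it is affordable because p_1 is coprime
    to q. So psi is about 1/h just before q', and (d3) identifies this with
    Phi (q' - 1), as q' is close to L. Finally, 1/h is arbitrarily small compared
    with the fixed q, which gives (C3).

    The free move ([dyadic_children]) only has to keep (C1): from p'/q', any
    point with denominator 2^e and odd numerators is allowed as long as it is
    closer to p'/q' than (Phi Q)/q' for all Q in [q', 2^e). Under (d4) this
    leaves about (2^(e (1 - gamma)))^m points at mutual distance 2^-e, which is
    the count needed for dimension m (1 - gamma). Odd numerators over a power of
    two also restore the coprimality that the next exact move needs. *)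

(** * Archimedean bounds *)

Section Bounds.
Context {R : realType}.

Lemma natr_ge (x : R) : exists n : nat, x <= n%:R.
Proof.
exists (Num.bound `|x|); apply: le_trans (ler_norm x) _.
exact: ltW (archi_boundP (normr_ge0 x)).
Qed.

Lemma exists_natV_lt (e : R) : 0 < e -> exists k0 : nat,
  forall k, (k0 <= k)%N -> k.+1%:R^-1 < e.
Proof.
move=> e0; have [k0 hk0] : exists k0 : nat, e^-1 < k0%:R.
  by exists (Num.bound e^-1); apply: archi_boundP; rewrite invr_ge0 ltW.
exists k0 => k k0k; rewrite invf_plt ?posrE//.
by rewrite (lt_le_trans hk0)// ler_nat (leq_trans k0k).
Qed.

Lemma expn2_gt (n : nat) : exists e0, forall e, (e0 <= e)%N -> (n < 2 ^ e)%N.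
Proof.
by exists n => e ne; apply: leq_ltn_trans ne _; exact: ltn_expl.
Qed.

Lemma div_expn2_small (a c : R) : 0 < c ->
  exists e0, forall e, (e0 <= e)%N -> a / (2 ^ e)%:R <= c.
Proof.
move=> c0; have [n hn] := natr_ge (a / c).
have [e0 he0] := expn2_gt n; exists e0 => e /he0 ne.
rewrite ler_pdivrMr ?ltr0n ?expn_gt0// mulrC -ler_pdivrMr//.
by apply: le_trans hn _; rewrite ler_nat ltnW.
Qed.

Lemma powR_expn2_large (a M : R) : 0 < a -> exists e0, forall e, (e0 <= e)%N ->
  M <= (2 ^ e)%:R `^ a.
Proof.
move=> a0; have M0 : 0 <= Num.max M 0 by rewrite le_max lexx orbT.
have [n hn] := natr_ge (Num.max M 0 `^ a^-1).
have [e0 he0] := expn2_gt n; exists e0 => e /he0 ne.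
apply: (@le_trans _ _ (Num.max M 0)); first by rewrite le_max lexx.
have -> : Num.max M 0 = (Num.max M 0 `^ a^-1) `^ a.
  by rewrite -powRrM mulVf ?powRr1// gt_eqF.
apply: ge0_ler_powR; rewrite ?nnegrE ?powR_ge0 ?ltW//.
by apply: le_lt_trans hn _; rewrite ltr_nat.
Qed.

Lemma truncn_ge_half (x : R) : 1 <= x ->
  exists n : nat, [/\ (0 < n)%N, n%:R <= x & x / 2 <= n%:R].
Proof.
move=> x1; exists (Num.truncn x).
have /andP[lo hi] := truncn_itv (le_trans ler01 x1).
have n0 : (0 < Num.truncn x)%N.
  by rewrite -ltnS -(ltr_nat R); apply: le_lt_trans hi.
split => //.
have : 1 <= (Num.truncn x)%:R :> R by rewrite ler1n.
by move: hi; rewrite -natr1; lra.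
Qed.

End Bounds.

(** * Distance to the integers and the function psi *)

Section DistInt.
Context {R : realType}.
Implicit Types (x y c : R).

Lemma dist_int_set_neq0 x : [set `|x - n%:~R| | n in [set: int]] !=set0.
Proof. by exists `|x - 0%:~R|, 0. Qed.

Lemma dist_int_le x (z : int) : dist_int x <= `|x - z%:~R|.
Proof.
apply: ge_inf; last by exists z.
by exists 0 => _ [n _ <-]; exact: normr_ge0.
Qed.

Lemma dist_int_ge0 x : 0 <= dist_int x.
Proof.
apply: lb_le_inf; first exact: dist_int_set_neq0.
by move=> _ [n _ <-]; exact: normr_ge0.
Qed.

Lemma dist_int_lt x c : dist_int x < c -> exists z : int, `|x - z%:~R| < c.
Proof.
move=> /(inf_lt (dist_int_set_neq0 x)) [_ [z _ <-] zc].
by exists z.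
Qed.

Variable m : nat.
Implicit Types v w : 'rV[R]_m.

Lemma dist_int_vec_ge0 v : 0 <= dist_int_vec v.
Proof.
rewrite /dist_int_vec; elim/big_ind: _ => //= [a b a0 b0|i _].
  by rewrite le_max a0.
exact: dist_int_ge0.
Qed.

Lemma dist_int_vec_le v c : 0 <= c ->
  (forall i, exists z : int, `|v ord0 i - z%:~R| <= c) -> dist_int_vec v <= c.
Proof.
move=> c0 h; apply: bigmax_le => // i _.
by have [z] := h i; exact/le_trans/dist_int_le.
Qed.

Lemma le_dist_int_vec v i : dist_int (v ord0 i) <= dist_int_vec v.
Proof. exact: (le_bigmax _ (fun i => dist_int (v ord0 i))). Qed.

Lemma psi_le (xi : 'rV[R]_m) (q : nat) (Q : R) : (0 < q)%N -> q%:R <= Q ->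
  psi xi Q <= dist_int_vec (q%:R *: xi).
Proof.
move=> q0 qQ; apply: ge_inf; last by exists q.
by exists 0 => _ [n _ <-]; exact: dist_int_vec_ge0.
Qed.

Lemma psi_ge (xi : 'rV[R]_m) (Q c : R) : 1 <= Q ->
  (forall q : nat, (0 < q)%N -> q%:R <= Q -> c <= dist_int_vec (q%:R *: xi)) ->
  c <= psi xi Q.
Proof.
move=> Q1 h; apply: lb_le_inf; first by exists (dist_int_vec (1%:R *: xi)), 1%N.
by move=> _ [n [n0 nQ] <-]; exact: h.
Qed.

Lemma psi_ge0 (xi : 'rV[R]_m) (Q : R) : 1 <= Q -> 0 <= psi xi Q.
Proof. by move=> Q1; apply: psi_ge => // q _ _; exact: dist_int_vec_ge0. Qed.

End DistInt.

(** * Premeasures forced to be infinite by separated points *)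

Section Packing.
Context {R : realType} {V : normedModType R}.
Implicit Types (E F : set V) (s : R).
Local Open Scope ereal_scope.

Lemma packing_premeasure_delta_ge0 s (d : R) E :
  0 <= packing_premeasure_delta s d E.
Proof.
apply: ereal_sup_ubound; exists set0; last by rewrite esum_set0.
split; [exact: countable0|by move=> p []|by move=> i j []].
Qed.

Lemma packing_premeasure_ge0 s E : 0 <= packing_premeasure s E.
Proof.
by apply: le_ereal_inf_tmp => _ [d d0 <-]; exact: packing_premeasure_delta_ge0.
Qed.

(** A null set has covers of total premeasure less than 1, so each piece of such
    a cover has finite premeasure. This is the form in which a covering enters
    the category argument. *)
Lemma packing_measure0_cover s F : packing_measure s F = 0 ->
  exists2 E : nat -> set V, F `<=` \bigcup_i E i &
    forall i, packing_premeasure s (E i) < +oo.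
Proof.
move=> F0.
have : packing_measure s F < 1 by rewrite F0 lte01.
move=> /ereal_inf_lt[_ [E FE <-] sE].
exists E => // i; apply: le_lt_trans (lt_trans sE (ltry 1)).
apply: le_trans (nneseries_lim_ge i.+1 _) => [|j _ _]; last first.
  exact: packing_premeasure_ge0.
rewrite big_nat_recr//= leeDr//; apply: sume_ge0 => j _.
exact: packing_premeasure_ge0.
Qed.

(** Balls of equal radius r about points more than 2r apart form a packing, so
    it suffices to find, at arbitrarily small scales, such families whose size
    outgrows (2r)^-s. *)
Lemma packing_premeasure_pinfty s E :
  (forall M r0 : R, (0 < r0)%R -> exists (r : R) (I : finType) (x : I -> V),
    [/\ (0 < r <= r0)%R, (forall i, E (x i)),
        (forall i j, i != j -> (2 * r < `|x i - x j|)%R) &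
        (M <= #|I|%:R * (2 * r) `^ s)%R]) ->
  packing_premeasure s E = +oo.
Proof.
move=> h; apply/eqP; rewrite -leye_eq.
apply: le_ereal_inf_tmp => _ [r0 /= r00 <-]; rewrite leye_eq; apply/eqP/eqyP => M _.
have [r [I [x [/andP[r_gt0 rr0] xE xsep MN]]]] := h M r0 r00.
have xinj : injective (fun i => (x i, r)).
  move=> i j [xij]; apply/eqP/negPn/negP => /xsep.
  by rewrite xij subrr normr0 ltNge mulr_ge0// ltW.
have Dfin : finite_set [set (x i, r) | i in [set: I]].
  exact: finite_image.
apply: (@le_trans _ _ (\esum_(p in [set (x i, r) | i in [set: I]])
    ((2 * p.2) `^ s)%:E)); last first.
  apply: ereal_sup_ubound; exists [set (x i, r) | i in [set: I]] => //.
  split.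
  - exact: finite_set_countable.
  - by move=> _ [i _ <-] /=; split; [exact: xE|rewrite r_gt0].
  - move=> _ _ [i _ <-] [j _ <-] /= [z []].
    rewrite !closed_ballE// /closed_ball_/= => xi xj.
    congr (x _, r); apply/eqP/negPn/negP => /xsep; rewrite ltNge.
    rewrite (_ : x i - x j = (x i - z) - (x j - z))%R; last first.
      by rewrite opprB addrA subrK.
    by rewrite (le_trans (ler_normB _ _))// mulr_natl mulr2n lerD.
apply: esum_ge; exists [set (x i, r) | i in [set: I]]; first by split.
rewrite fsbig_image/=; last by move=> i j _ _; exact: xinj.
have -> : [set: I] = [set` enum I].
  by apply/seteqP; split => i //= _; rewrite mem_enum.
rewrite -fsbig_seq ?enum_uniq// big_enum/= sumEFin lee_fin.
by rewrite sumr_const -[leRHS]mulr_natl.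
Qed.

End Packing.

(** * Nested cubes and a category argument for trees *)

Section Cubes.
Context {R : realType} {m : nat}.

Definition cube (c : 'rV[R]_m) (r : R) : set 'rV[R]_m :=
  [set x | forall i, `|x ord0 i - c ord0 i| <= r].

Lemma cube_nonincreasing (c : nat -> 'rV[R]_m) (r : nat -> R) :
  (forall k, cube (c k.+1) (r k.+1) `<=` cube (c k) (r k)) ->
  forall k l, (k <= l)%N -> cube (c l) (r l) `<=` cube (c k) (r k).
Proof.
move=> sub k l; elim: l => [|l IH]; first by rewrite leqn0 => /eqP ->.
by rewrite leq_eqVlt ltnS => /predU1P[->//|/IH kl]; exact: subset_trans kl.
Qed.

(** Nested intervals in each coordinate: the common point has as coordinates the
    suprema of the lower endpoints. *)
Lemma nested_cubes (c : nat -> 'rV[R]_m) (r : nat -> R) :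
  (forall k, 0 <= r k) ->
  (forall k, cube (c k.+1) (r k.+1) `<=` cube (c k) (r k)) ->
  exists x, forall k, cube (c k) (r k) x.
Proof.
move=> r0 sub.
have low k l i : (k <= l)%N ->
    c k ord0 i - r k <= c l ord0 i - r l <= c k ord0 i + r k.
  (* The lower corner of a cube lies in all the earlier cubes. *)
  move=> kl; have : cube (c l) (r l) (c l - const_mx (r l)).
    by move=> j; rewrite !mxE addrAC subrr add0r normrN ger0_norm.
  move=> /(cube_nonincreasing sub kl)/(_ i).
  by rewrite !mxE ler_distl.
pose lows i := [set c k ord0 i - r k | k in [set: nat]].
have ubl i k : ubound (lows i) (c k ord0 i + r k).
  move=> _ [l _ <-]; have [lk|/ltnW kl] := leqP l k.
    have /andP[+ _] := low _ _ i lk; move/le_trans; apply.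
    by rewrite lerD2l (le_trans _ (r0 k))// oppr_le0.
  by have /andP[] := low _ _ i kl.
have lows0 i : lows i !=set0 by exists (c 0%N ord0 i - r 0%N), 0%N.
exists (\row_i sup (lows i)) => k i; rewrite mxE ler_distl; apply/andP; split.
  by apply: ub_le_sup; [exists (c k ord0 i + r k); exact: ubl|exists k].
by apply: ge_sup => //; exact: ubl.
Qed.

Lemma coord_le_norm (v : 'rV[R]_m) i : `|v ord0 i| <= `|v|.
Proof.
rewrite [leRHS]/Num.Def.normr /= mx_normrE.
by apply/bigmax_geP; right; exists (ord0, i).
Qed.

End Cubes.

(** Baire's theorem for trees: otherwise one could choose, at each level i, a
    child whose set B avoids E_i, and the limit of the resulting branch would be
    a point of F outside all the E_i. The level indexes both the child relation
    and the covering sets, so that one branch avoids all of them in turn. *)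
Lemma tree_category (T S : Type) (inv : S -> Prop)
    (child : nat -> S -> S -> Prop)
    (B : S -> set T) (F : set T) (E : nat -> set T) (s0 : S) :
  inv s0 -> (forall i s s', child i s s' -> inv s') ->
  (forall u : nat -> S, (forall i, inv (u i)) ->
    (forall i, child i (u i) (u i.+1)) ->
    exists2 x, F x & forall i, B (u i) x) ->
  F `<=` \bigcup_i E i ->
  exists i s, inv s /\ forall s', child i s s' -> B s' `&` E i !=set0.
Proof.
move=> inv0 inv_child lim FE; apply: contrapT => none.
have avoid (p : nat * S) : exists s', inv p.2 ->
    child p.1 p.2 s' /\ ~ (B s' `&` E p.1 !=set0).
  apply: contrapT => /forallNP h; apply: none; exists p.1, p.2.
  have invp : inv p.2.
    by apply: contrapT => ninv; apply: (h p.2).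
  split=> // s' cs'; apply: contrapT => nE.
  by apply: (h s').
have [f fP] := choice avoid.
pose u := fix u i := if i is i'.+1 then f (i', u i') else s0.
have invu i : inv (u i).
  by elim: i => [|i IH]//=; have [/inv_child] := fP (i, u i) IH.
have [x Fx Bx] := lim u invu (fun i => (fP (i, u i) (invu i)).1).
have [i _ Eix] := FE x Fx.
by apply: (fP (i, u i) (invu i)).2; exists x; split => //; exact: (Bx i.+1).
Qed.

(** * Solutions from infinitely many good steps *)

Section Steps.
Context {R : realType} {m : nat}.
Variable Phi : nat -> R.
Hypothesis Phi01 : maps_to_01 Phi.
Implicit Types xi : 'rV[R]_m.

(** What is to be secured at level k of the tree, between two consecutive
    denominators: (C1) in between, (C2) with error 1/(k+1), and the bound
    that gives (C3) for all exponents up to k. *)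
Definition good_step (k q q' : nat) xi : Prop :=
  [/\ forall Q : nat, (q <= Q < q')%N -> psi xi Q%:R < Phi Q,
      exists2 Q : nat, (q <= Q)%N & (1 - k.+1%:R^-1) * Phi Q < psi xi Q%:R
    & q%:R ^+ k * psi xi q%:R <= k.+1%:R^-1].

Lemma claim_C3_of_small xi :
  (forall (N : nat) (e M : R), 0 < e ->
    exists Q : R, [/\ M < Q, 1 <= Q & Q ^+ N * psi xi Q <= e]) ->
  claim_C3 xi.
Proof.
move=> small N; rewrite limf_einfE; apply/eqP; rewrite eq_le; apply/andP; split.
  apply: ge_ereal_sup => _ [A [M [Mreal MA]] <-].
  apply/lee_addgt0Pr => e e0; rewrite add0e.
  have [Q [MQ _ Qe]] := small N e M e0.
  apply: (@le_trans _ _ (Q ^+ N * psi xi Q)%:E); last by rewrite lee_fin.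
  by apply: ereal_inf_lbound; exists Q => //; exact: MA.
apply: ereal_sup_ge; exists (ereal_inf
    [set (Q ^+ N * psi xi Q)%:E | Q in [set Q : R | 1 < Q]]).
  by exists [set Q : R | 1 < Q] => //; exists 1; split.
apply: le_ereal_inf_tmp => _ [Q /= /ltW Q1 <-].
by rewrite lee_fin mulr_ge0 ?psi_ge0// exprn_ge0// (le_trans _ Q1).
Qed.

Lemma solutions_of_good_steps (q : nat -> nat) xi :
  (0 < q 0)%N -> (forall k, (q k < q k.+1)%N) ->
  (forall k, good_step k (q k) (q k.+1) xi) -> solutions Phi xi.
Proof.
move=> q0 qS steps.
have qk k : (k < q k)%N.
  by elim: k => [//|k IH]; exact: leq_ltn_trans (qS k).
split.
- exists (q 0%N) => Q q0Q.
  have [k Qk] : exists k, (q k <= Q < q k.+1)%N.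
    have exk : exists k, (Q < q k)%N by exists Q.
    case: (ex_minnP exk) => -[|k] Qk mink; first by rewrite ltnNge q0Q in Qk.
    exists k; rewrite Qk andbT leqNgt; apply/negP => /mink.
    by rewrite ltnn.
  by have [h _ _] := steps k; exact: h.
- move=> eps eps0 Q1.
  have [k0 hk0] := exists_natV_lt eps0.
  have k0k : (k0 <= maxn k0 Q1)%N by rewrite leq_maxl.
  have [_ [Q qQ hQ] _] := steps (maxn k0 Q1).
  have Q1Q : (Q1 <= Q)%N.
    by rewrite (leq_trans _ qQ)// (leq_trans _ (ltnW (qk _)))// leq_maxr.
  exists Q => //; apply: le_lt_trans hQ; apply: ler_wpM2r.
    have Qgt0 : (0 < Q)%N by rewrite (leq_trans _ qQ)// (leq_trans _ (qk _)).
    by have /andP[/ltW] := Phi01 Qgt0.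
  by rewrite lerD2l lerN2 ltW// hk0.
- apply: claim_C3_of_small => N e M e0.
  have [k0 hk0] := exists_natV_lt e0.
  pose k := maxn (maxn k0 N) (Num.bound `|M|).
  have [k0k Nk Mk] : [/\ (k0 <= k)%N, (N <= k)%N & (Num.bound `|M| <= k)%N].
    by rewrite /k !leq_max !leqnn !orbT.
  exists (q k)%:R.
  have q1 : 1 <= (q k)%:R :> R by rewrite ler1n (leq_trans _ (qk k)).
  split => //.
    apply: le_lt_trans (ler_norm M) _.
    apply: lt_le_trans (archi_boundP (normr_ge0 M)) _.
    by rewrite ler_nat (leq_trans Mk)// ltnW.
  have [_ _ h] := steps k.
  apply: le_trans (ltW (hk0 k k0k)); apply: le_trans h.
  by rewrite ler_wpM2r ?psi_ge0// ler_weXn2l.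
Qed.

End Steps.

(** * Integer multiples far from the integer points *)

Section Separation.
Context {R : realType}.

Lemma int_norm_lt1 (E : int) : `|E%:~R : R| < 1 -> E = 0.
Proof. by rewrite -intr_norm -[1]/(1%:~R) ltr_int; lia. Qed.

(** One link of the triangular system: if n is a multiple of a, the coordinate
    n (p/q + 1/(ad)) is an integer plus (n/a)/d, and a nonzero fraction with
    denominator d <= h is at distance 1/h at least from 0. *)
Lemma chain_separation (q h a d : nat) (p n z : int) :
  (0 < q)%N -> (0 < a)%N -> (0 < d <= h)%N -> (q %| a)%N -> (a%:Z %| n)%Z ->
  `|n%:~R * (p%:~R / q%:R + (a * d)%:R^-1) - z%:~R| < (h%:R : R)^-1 ->
  ((a * d)%N%:Z %| n)%Z.
Proof.
move=> q0 a0 /andP[d0 dh] /dvdnP[a' a'E] /dvdzP[n' ->] hz.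
have q0R : (q%:R : R) != 0 by rewrite pnatr_eq0 -lt0n.
have d0R : 0 < (d%:R : R) by rewrite ltr0n.
have a'0R : (a'%:R : R) != 0.
  by rewrite pnatr_eq0 -lt0n; move: a0; rewrite a'E muln_gt0 => /andP[].
pose E : int := n' + d%:Z * (n' * a'%:Z * p - z).
have /int_norm_lt1 E0 : `|E%:~R : R| < 1.
  have EE : (n' * a%:Z)%:~R * (p%:~R / q%:R + (a * d)%:R^-1) - z%:~R
      = E%:~R / d%:R :> R.
    rewrite /E a'E !(natrM, PoszM, intrM, intrD, intrN) -!pmulrn.
    by field; rewrite q0R a'0R gt_eqF.
  move: hz; rewrite EE normrM normfV (ger0_norm (ltW d0R)) ltr_pdivrMr// => hz.
  apply: lt_le_trans hz _; rewrite mulrC ler_pdivrMr ?mul1r ?ler_nat//.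
  by rewrite ltr0n (leq_trans d0).
apply/dvdzP; exists (z - n' * a'%:Z * p).
have {1}-> : n' = d%:Z * (z - n' * a'%:Z * p) by rewrite -[LHS]subr0 -E0 /E; ring.
rewrite PoszM; ring.
Qed.

(** The first two coordinates have to be treated together. Closeness to an
    integer in the first one writes n as r (1 - p0 h) + q h j with |r| < q;
    put into the second one, this leaves the integer E plus r/h over d, so E
    vanishes, and E = - p0 r modulo q. As p0 is coprime to q this kills r, and
    then E = 0 says that d divides q j. *)
Lemma head_separation (q h d : nat) (p0 p1 n z0 z1 : int) :
  (0 < q)%N -> (0 < h)%N -> (q %| h)%N -> (0 < d <= h)%N -> (q ^ 2 %| d)%N ->
  coprimez p0 q%:Z ->
  `|n%:~R * (p0%:~R / q%:R + (q * h)%:R^-1) - z0%:~R| < (h%:R : R)^-1 ->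
  `|n%:~R * (p1%:~R / q%:R + (h * d)%:R^-1) - z1%:~R|
    < (h%:R : R)^-1 * (1 - q%:R / d%:R) ->
  ((h * d)%N%:Z %| n)%Z.
Proof.
move=> q0 h0 /dvdnP[h' h'E] /andP[d0 dh] /dvdnP[d' d'E] cop hz0 hz1.
have q0R : 0 < (q%:R : R) by rewrite ltr0n.
have h0R : 0 < (h%:R : R) by rewrite ltr0n.
have d0R : 0 < (d%:R : R) by rewrite ltr0n.
pose r : int := n * (p0 * h%:Z + 1) - z0 * (q * h)%:Z.
have rq : `|r%:~R : R| < q%:R.
  have -> : r%:~R = (n%:~R * (p0%:~R / q%:R + (q * h)%:R^-1) - z0%:~R)
      * (q%:R * h%:R) :> R.
    rewrite /r !(natrM, PoszM, intrM, intrD, intrN) -!pmulrn.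
    by field; rewrite !gt_eqF.
  rewrite normrM [X in _ * X]ger0_norm ?mulr_ge0 ?ltW// -lter_pdivlMr ?mulr_gt0//.
  by rewrite invfM mulrA divff ?mul1r ?gt_eqF.
pose j : int := z0 * (1 - p0 * h%:Z) + n * p0 ^+ 2 * h'%:Z.
(* This inverts 1 + p0 h modulo q h: the inverse is 1 - p0 h, as q divides h. *)
have nE : n = (1 - p0 * h%:Z) * r + q%:Z * h%:Z * j.
  by rewrite /j /r h'E !PoszM; ring.
pose E : int := d'%:Z * q%:Z * p1 * n - p0 * r + q%:Z * j - d%:Z * z1.
have Er : n%:~R * (p1%:~R / q%:R + (h * d)%:R^-1) - z1%:~R =
    (E%:~R + r%:~R / h%:R) / d%:R :> R.
  have d'q0 : (d'%:R : R) != 0.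
    by rewrite pnatr_eq0 -lt0n; move: d0; rewrite d'E muln_gt0 => /andP[].
  rewrite mulrDr {2}nE /E d'E.
  rewrite !(natrM, PoszM, intrM, intrD, intrN, expnS, expn0, muln1) -!pmulrn.
  by field; rewrite ?d'q0 !gt_eqF.
have /int_norm_lt1 E0 : `|E%:~R : R| < 1.
  move: hz1; rewrite Er normrM normfV (ger0_norm (ltW d0R)) ltr_pdivrMr// => hz1.
  have rh : `|r%:~R / h%:R : R| < q%:R / h%:R.
    by rewrite normrM normfV (ger0_norm (ltW h0R)) ltr_pM2r ?invr_gt0.
  have -> : E%:~R = (E%:~R + r%:~R / h%:R) - r%:~R / h%:R :> R by rewrite addrK.
  apply: le_lt_trans (ler_normB _ _) _.
  apply: lt_le_trans (ltrD hz1 rh) _.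
  have -> : h%:R^-1 * (1 - q%:R / d%:R) * d%:R + q%:R / h%:R = d%:R / h%:R :> R.
    by field; rewrite !gt_eqF.
  by rewrite ler_pdivrMr ?mul1r ?ler_nat.
have r0 : r = 0.
  have : (q%:Z %| r)%Z.
    rewrite -(Gauss_dvdzr _ (_ : coprimez q%:Z p0)) 1?coprimez_sym//.
    have -> : p0 * r = q%:Z * (d'%:Z * p1 * n + j - d'%:Z * q%:Z * z1).
      apply/eqP; rewrite -subr_eq0 -oppr_eq0 -E0 /E d'E.
      by rewrite !(PoszM, expnS, expn0, muln1); apply/eqP; ring.
    exact: dvdz_mulr.
  move=> /dvdzP[k rk]; move: rq.
  rewrite rk intrM -pmulrn normrM (ger0_norm (ltW q0R)) gtr_pMl//.
  by move=> /int_norm_lt1 ->; rewrite mul0r.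
move: E0 nE; rewrite /E r0 !mulr0 subr0 add0r => E0 nE.
have qj : q%:Z * j = d%:Z * (z1 - p1 * h%:Z * j).
  apply/eqP; rewrite -subr_eq0 -E0 nE d'E.
  by rewrite !(PoszM, expnS, expn0, muln1); apply/eqP; ring.
apply/dvdzP; exists (z1 - p1 * h%:Z * j).
by rewrite nE PoszM mulrAC qj; ring.
Qed.

End Separation.

(** * Choice of the scales *)

Section Scales.
Context {R : realType}.
Variables (m : nat) (Phi : nat -> R).
Hypothesis Phi01 : maps_to_01 Phi.

Lemma Phi_gt0 t : (0 < t)%N -> 0 < Phi t.
Proof. by move=> /Phi01/andP[]. Qed.

Lemma Phi_pos_min (T : nat) :
  exists2 c : R, 0 < c & forall Q, (0 < Q < T)%N -> c < Phi Q.
Proof.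
elim: T => [|T [c c0 cP]]; first by exists 1 => // Q; rewrite ltn0 andbF.
have [->|T0] := posnP T.
  by exists 1 => // Q; lia.
exists (Num.min c (Phi T / 2)).
  by rewrite lt_min c0 divr_gt0// Phi_gt0.
move=> Q /andP[Q0]; rewrite ltnS leq_eqVlt => /predU1P[->|QT].
  by rewrite gt_min ltr_pdivrMr// mulr_natr mulr2n ltrDl Phi_gt0 ?orbT.
by rewrite gt_min cP ?Q0 ?QT.
Qed.

Lemma cond_d2_ge (M : R) : cond_d2 m.+2 Phi ->
  exists T : nat, forall t, (T <= t)%N -> M <= t%:R `^ (m.+1%:R^-1) * Phi t.
Proof.
move=> /cvgryPge/(_ M)[T _ hT]; exists T => t Tt.
have := hT t Tt; rewrite /= (_ : m.+2%:R - 1 = m.+1%:R :> R)//.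
by rewrite -[m.+2]addn1 natrD addrK.
Qed.

Lemma root_powR (t : nat) : (t%:R `^ (m.+1%:R^-1)) ^+ m.+1 = t%:R :> R.
Proof. by rewrite -powR_mulrn ?powR_ge0// -powRrM mulVf ?powRr1. Qed.

(** Since L is the first place where Phi drops to about
    1/h, condition (d1) bounds it by h^(m+2) and hence C by h, while (d2) makes
    L, hence C, exceed any given multiple of h^(m+1). The ratio of L to
    C h^(m+1) - 1 is then slightly above 1, and (d3) compares the two values of
    Phi. *)
Lemma approximation_parameters (q G : nat) (kappa eps : R) :
  cond_d1 m.+2 Phi -> cond_d2 m.+2 Phi -> cond_d3 m.+2 Phi ->
  (0 < q)%N -> 0 < kappa <= 1 -> 0 < eps ->
  exists h C L : nat,
  [/\ [/\ (q ^ 2 %| h)%N, (q ^ 2 %| C)%N, (G <= C <= h)%N & (0 < C)%N],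
      (q < C * h ^ m.+1 <= L)%N,
      forall Q, (q <= Q < L)%N -> (1 + kappa) / h%:R < Phi Q,
      Phi L <= (1 + kappa) / h%:R &
      (1 - eps) * Phi (C * h ^ m.+1).-1 <= Phi L].
Proof.
move=> [t1 d1] d2 d3 q0 /andP[k0 k1] eps0.
have [eps1 [t0 [eps10 t00 d3P]]] := d3 eps eps0.
have [B1 hB1] := natr_ge ((q ^ 2)%:R / eps1).
have [B [GB t0B B1B]] : exists B, [/\ G <= B, t0 < B & B1.+2 < B]%N.
  by exists (G + t0 + B1 + 3)%N; split; lia.
have [T hT] := cond_d2_ge (2 * (q ^ 2 * B)%:R) d2.
have [c c0 cP] := Phi_pos_min T.
have [c1 hc1] := natr_ge (2 / c).
(* Below T the function Phi exceeds c, and 2/h <= c: this pushes L beyond T. *)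
pose h := (q ^ 2 * (t1 + q + c1 + 1))%N.
have q20 : (0 < q ^ 2)%N by rewrite expn_gt0 q0.
have hge : (t1 + q + c1 + 1 <= h)%N by rewrite leq_pmull.
have hq2 : (q ^ 2 %| h)%N by exact: dvdn_mulr.
clearbody h.
have [t1h qh c1h h0] : [/\ t1 <= h, q <= h, c1 <= h & 0 < h]%N.
  by clear -hge q0; split; lia.
have h0R : 0 < (h%:R : R) by rewrite ltr0n.
have hX : (0 < h ^ m.+1)%N by rewrite expn_gt0 h0.
have hpow : (h <= h ^ m.+2)%N by rewrite expnS leq_pmulr.
have PhihX : Phi (h ^ m.+2) < (h%:R)^-1.
  have /d1 := leq_trans t1h hpow.
  by rewrite powRN natrX -powR_mulrn// -powRrM mulfV ?powRr1// pnatr_eq0.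
have exL : exists Q, (q <= Q)%N && (Phi Q <= (1 + kappa) / h%:R).
  exists (h ^ m.+2)%N; rewrite (leq_trans qh hpow) /=.
  apply: le_trans (ltW PhihX) _; rewrite -[leLHS]mul1r ler_pM2r ?invr_gt0//.
  by rewrite lerDl ltW.
case: (ex_minnP exL) => L /andP[qL PhiL] Lmin.
have L0 : (0 < L)%N := leq_trans q0 qL.
have LhX : (L <= h ^ m.+2)%N.
  apply: Lmin; rewrite (leq_trans qh hpow) /=.
  apply: le_trans (ltW PhihX) _; rewrite -[leLHS]mul1r ler_pM2r ?invr_gt0//.
  by rewrite lerDl ltW.
have PhiL2 : Phi L <= 2 / h%:R.
  by apply: le_trans PhiL _; rewrite ler_pM2r ?invr_gt0//; lra.
have TL : (T <= L)%N.
  rewrite leqNgt; apply/negP => LT; have := cP L.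
  rewrite L0 LT => /(_ isT); apply/negP; rewrite -leNgt.
  apply: le_trans PhiL2 _; rewrite ler_pdivrMr// mulrC -ler_pdivrMr//.
  by apply: le_trans hc1 _; rewrite ler_nat.
have Lge : (q ^ 2 * B * h ^ m.+1 <= L)%N.
  rewrite -(ler_nat R) -(root_powR L).
  have Bh : (q ^ 2 * B * h)%:R <= L%:R `^ m.+1%:R^-1 :> R.
    have := le_trans (hT L TL) (ler_wpM2l (powR_ge0 _ _) PhiL2).
    by rewrite mulrCA ler_pM2l// ler_pdivlMr// -natrM.
  apply: (@le_trans _ _ ((q ^ 2 * B * h)%:R ^+ m.+1)); last first.
    by rewrite lerXn2r ?nnegrE ?powR_ge0.
  rewrite -natrX ler_nat expnMn leq_mul2r; apply/orP; right.
  by rewrite [leqRHS]expnS leq_pmulr// expn_gt0 muln_gt0 q20; case: (B) B1B.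
pose X := (q ^ 2 * h ^ m.+1)%N.
have X0 : (0 < X)%N by rewrite muln_gt0 q20.
pose C := (q ^ 2 * (L %/ X))%N.
have CXE : (C * h ^ m.+1 = L %/ X * X)%N by rewrite /C /X mulnCA mulnA.
have BC : (B <= C)%N.
  rewrite /C (leq_trans (leq_pmull B q20))// leq_mul2l leq_divRL// .
  by rewrite /X mulnA [(B * _)%N]mulnC Lge orbT.
have CL : (C * h ^ m.+1 <= L)%N by rewrite CXE leq_trunc_div.
have Ch : (C <= h)%N.
  have := leq_trans CL LhX; rewrite [(h ^ m.+2)%N]expnS leq_mul2r.
  by rewrite expn_eq0 -[h == 0%N]negbK -lt0n h0.
have LX : (L < C * h ^ m.+1 + X)%N.
  by rewrite CXE {1}(divn_eq L X) ltn_add2l ltn_mod.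
exists h, C, L; split => //.
- split; [by []|exact: dvdn_mulr|by rewrite Ch andbT (leq_trans GB)|].
  by rewrite (leq_trans _ BC)// (leq_trans _ B1B).
- rewrite CL andbT (@leq_trans (C * h)%N)//.
    rewrite (leq_ltn_trans qh)// -[X in (X < _)%N]mul1n ltn_mul2r h0.
    by rewrite (leq_trans _ BC)// (leq_trans _ B1B).
  by rewrite leq_mul2l expnS leq_pmulr ?orbT// expn_gt0 h0.
- move=> Q /andP[qQ QL]; rewrite ltNge; apply/negP => PhiQ.
  by have := Lmin Q; rewrite qQ PhiQ => /(_ isT); rewrite leqNgt QL.
set t := (C * h ^ m.+1).-1.
have tS : t.+1 = (C * h ^ m.+1)%N.
  by rewrite prednK// muln_gt0 hX (leq_trans _ BC)// (leq_trans _ B1B).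
have C1t : ((C - 1) * h ^ m.+1 <= t)%N.
  rewrite /t mulnBl mul1n.
  by rewrite -subn1 leq_sub2l.
have t0t : (t0 <= t)%N.
  apply: leq_trans C1t; apply: (@leq_trans (C - 1)%N); last by rewrite leq_pmulr.
  rewrite leq_subRL ?add1n ?(leq_trans t0B)// (leq_trans _ BC)//.
  by rewrite (leq_trans _ B1B).
have tgt0 : (0 < t)%N := leq_trans t00 t0t.
have tgt0R : 0 < (t%:R : R) by rewrite ltr0n.
have := d3P (L%:R / t%:R) t L.
rewrite divfK ?lt0r_neq0// => h3.
rewrite -ler_pdivlMr ?Phi_gt0//; apply: h3 => //.
have alpha1 : 1 < L%:R / t%:R :> R.
  by rewrite ltr_pdivlMr// mul1r ltr_nat tS.
(* The ratio exceeds 1, which puts it in the range of (d3) in either case. *)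
apply/andP; split.
  by case: ifP => // _; apply: lt_trans alpha1; rewrite ltrBlDr ltrDl.
rewrite ltr_pdivrMr// mulrDl mul1r.
have LtX : (L <= t + X)%N by rewrite -ltnS -addSn tS.
apply: (@le_lt_trans _ _ (t + X)%:R); first by rewrite ler_nat.
rewrite natrD ltrD2l mulrC -ltr_pdivrMr//.
(* What remains is q^2 < eps1 (C - 1), the reason for the bound B1. *)
rewrite /X natrM mulrAC -ltr_pdivlMr ?ltr0n//.
apply: le_lt_trans hB1 _; rewrite ltr_pdivlMr ?ltr0n// -natrM ltr_nat.
apply: leq_trans C1t; rewrite ltn_mul2r hX /=.
by rewrite ltn_subRL add1n (leq_trans (ltnW B1B)).
Qed.

End Scales.

(** * The shifted rational point *)

Section ExactStep.
Context {R : realType} {m : nat}.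

Definition rat_point (d : nat) (q : nat) (p : 'rV[int]_d) : 'rV[R]_d :=
  \row_i ((p ord0 i)%:~R / q%:R).

(** The denominators of the shift (1/(qh), 1/h^2, ..., 1/h^(m+1), 1/(C h^(m+1))).
    For m = 0 only the two extreme ones occur. *)
Definition shift_den (q h C i : nat) : nat :=
  if i == 0%N then (q * h)%N
  else if i == m.+1 then (C * h ^ m.+1)%N else (h ^ i.+1)%N.

Definition shift_num (q h C : nat) (p : 'rV[int]_m.+2) : 'rV[int]_m.+2 :=
  \row_i (((C * h ^ m.+1) %/ q)%N%:Z * p ord0 i
          + ((C * h ^ m.+1) %/ shift_den q h C i)%N%:Z).

Section Shift.
Variables (q h C : nat) (p : 'rV[int]_m.+2).
Hypotheses (q0 : (0 < q)%N) (C0 : (0 < C)%N) (Ch : (C <= h)%N).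
Hypotheses (qh : (q ^ 2 %| h)%N) (qC : (q ^ 2 %| C)%N).

Let h0 : (0 < h)%N. Proof. exact: leq_trans Ch. Qed.
Let q_dvd_C : (q %| C)%N. Proof. by apply: dvdn_trans qC; rewrite expnS dvdn_mulr. Qed.
Let q_dvd_h : (q %| h)%N. Proof. by apply: dvdn_trans qh; rewrite expnS dvdn_mulr. Qed.

Lemma shift_den_dvd i : (i <= m.+1)%N -> (shift_den q h C i %| C * h ^ m.+1)%N.
Proof.
rewrite /shift_den; case: eqP => [_ _|_ im].
  by rewrite dvdn_mul// expnS dvdn_mulr.
case: eqP => // /eqP im1; apply: dvdn_mull; apply: dvdn_exp2l.
by rewrite ltn_neqAle im1 im.
Qed.

Lemma shift_den_ge i : (q * h <= shift_den q h C i)%N.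
Proof.
have qlC : (q <= C)%N := dvdn_leq C0 q_dvd_C.
rewrite /shift_den; case: eqP => // /eqP i0; case: eqP => _.
  by rewrite leq_mul// expnS leq_pmulr// expn_gt0 h0.
rewrite -(prednK (n := i)) ?lt0n// !expnS mulnA.
rewrite (leq_trans (n := h * h))//; first by rewrite leq_mul2r (leq_trans qlC Ch) orbT.
by rewrite leq_pmulr// expn_gt0 h0.
Qed.

Lemma rat_point_shift i : rat_point (C * h ^ m.+1) (shift_num q h C p) ord0 i =
  (p ord0 i)%:~R / q%:R + (shift_den q h C i)%:R^-1.
Proof.
have /dvdnP[a aE] : (q %| C * h ^ m.+1)%N by exact: dvdn_mulr.
have /dvdnP[b bE] := @shift_den_dvd i (ltnSE (ltn_ord i)).
have s0 : (0 < shift_den q h C i)%N.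
  by apply: leq_trans (shift_den_ge i); rewrite muln_gt0 q0.
have Q0 : (0 < C * h ^ m.+1)%N by rewrite muln_gt0 C0 expn_gt0 h0.
rewrite !mxE {1}aE {1}bE !mulnK// intrD intrM -!pmulrn mulrDl.
have Q0R : ((C * h ^ m.+1)%:R : R) != 0 by rewrite pnatr_eq0 -lt0n.
congr (_ + _).
  have := Q0R; rewrite aE natrM mulf_eq0 negb_or => /andP[a0 q0'].
  by field; rewrite a0 q0'.
have := Q0R; rewrite bE natrM mulf_eq0 negb_or => /andP[b0 s0'].
by field; rewrite b0 s0'.
Qed.

(** Each coordinate yields one more factor: [head_separation] starts with the
    first two, and [chain_separation] adds h at each of the next ones and C at
    the last one. *)
Lemma shift_separation (n : int) : coprimez (p ord0 ord0) q%:Z ->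
  (forall i, exists z : int,
    `|n%:~R * rat_point (C * h ^ m.+1) (shift_num q h C p) ord0 i - z%:~R|
      < (h%:R : R)^-1 * (1 - q%:R / C%:R)) ->
  ((C * h ^ m.+1)%N%:Z %| n)%Z.
Proof.
move=> cop near_int.
have h0R : 0 < (h%:R : R) by rewrite ltr0n.
have C0R : 0 < (C%:R : R) by rewrite ltr0n.
have near_h (d i : nat) (im : (i < m.+2)%N) : (C <= d)%N -> exists z : int,
    `|n%:~R * ((p ord0 (Ordinal im))%:~R / q%:R + (shift_den q h C i)%:R^-1)
       - z%:~R| < (h%:R : R)^-1 * (1 - q%:R / d%:R).
  move=> Cd; have [z hz] := near_int (Ordinal im); exists z.
  move: hz; rewrite rat_point_shift => /lt_le_trans; apply.
  rewrite ler_pM2l ?invr_gt0// lerD2l lerN2 ler_wpM2l ?ler0n//.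
  by rewrite lef_pV2 ?posrE ?ler_nat// ltr0n (leq_trans C0).
have lt_h (d : nat) : (C <= d)%N ->
    (h%:R : R)^-1 * (1 - q%:R / d%:R) < h%:R^-1.
  move=> Cd; rewrite gtr_pMr ?invr_gt0// ltrBlDr ltrDl divr_gt0 ?ltr0n//.
  exact: leq_trans Cd.
have near_h' (i : nat) (im : (i < m.+2)%N) : exists z : int,
    `|n%:~R * ((p ord0 (Ordinal im))%:~R / q%:R + (shift_den q h C i)%:R^-1)
       - z%:~R| < (h%:R : R)^-1.
  by have [z /lt_trans hz] := near_h C i im (leqnn C); exists z; exact/hz/lt_h.
have [z0 hz0] := near_h' 0%N isT.
(* In dimension two the second coordinate is already the last one. *)
pose d1 := if m == 0%N then C else h.
have [Cd1 d1h] : (C <= d1)%N /\ (d1 <= h)%N.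
  by rewrite /d1; case: ifP; split.
have [z1 hz1] := near_h d1 1%N isT Cd1.
have hd1 : shift_den q h C 1 = (h * d1)%N.
  rewrite /shift_den /d1 /= eqSS eq_sym; case: eqP => [->|_].
    by rewrite expn1 mulnC.
  by rewrite expnS expn1.
rewrite hd1 in hz1.
have head_dvd : ((h * d1)%N%:Z %| n)%Z.
  apply: (head_separation (R := R)) hz0 hz1 => //.
    by rewrite d1h (leq_trans C0).
    by rewrite /d1; case: ifP.
  by rewrite (_ : Ordinal _ = ord0)//; exact: val_inj.
have step i (im : (i.+1 < m.+2)%N) : (0 < i)%N -> ((h ^ i.+1)%N%:Z %| n)%Z ->
    ((shift_den q h C i.+1)%N%:Z %| n)%Z.
  move=> i0 hi; have [z] := near_h' i.+1 im.
  pose d := if i.+1 == m.+1 then C else h.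
  have -> : shift_den q h C i.+1 = (h ^ i.+1 * d)%N.
    rewrite /shift_den /d /=; case: eqP => [[->]|_]; first by rewrite mulnC.
    by rewrite -expnSr.
  apply: chain_separation => //; first by rewrite expn_gt0 h0.
    by rewrite /d; case: ifP => _; rewrite ?C0 ?h0 /=.
  by rewrite expnS dvdn_mulr.
have [m0|m0] := posnP m.
  by move: head_dvd; rewrite /d1 m0 /= expn1 mulnC.
have powers i : (0 < i <= m)%N -> ((h ^ i.+1)%N%:Z %| n)%Z.
  elim: i => [//|[_ _|i IH /andP[_ im]]].
    by move: head_dvd; rewrite /d1 gtn_eqF// expnS expn1.
  have im2 : (i.+2 < m.+2)%N by rewrite ltnS (leq_trans im).
  have := step i.+1 im2 isT (IH (ltnW im)).
  by rewrite /shift_den /= ltn_eqF// ltnS.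
have := step m (ltnSn _) m0 (powers m _).
by rewrite m0 leqnn /shift_den /= eqxx => /(_ isT).
Qed.

End Shift.
End ExactStep.

(** * The exact move *)

Section ExactStepExists.
Context {R : realType} {m : nat}.
Variable Phi : nat -> R.
Hypotheses (Phi01 : maps_to_01 Phi) (h1 : cond_d1 m.+2 Phi)
  (h2 : cond_d2 m.+2 Phi) (h3 : cond_d3 m.+2 Phi).

(** The point w of the introduction, with a radius tau' so small that n xi stays
    within kappa/h of n w for all n up to q'. Points xi of the small cube then
    have psi at most (1 + kappa)/h from q on, which is less than Phi up to L, and
    at least (1 - 2 kappa)/h up to q' - 1; the value of Phi at q' - 1 is at most
    (1 + kappa)/((1 - kappa) h). *)
Lemma exact_step (k q : nat) (p : 'rV[int]_m.+2) (tau : R) :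
  (0 < q)%N -> coprimez (p ord0 ord0) q%:Z -> 0 < tau ->
  exists (q' : nat) (p' : 'rV[int]_m.+2) (tau' : R),
  [/\ (q < q')%N, 0 < tau', cube (rat_point q' p') tau' `<=` cube (rat_point q p) tau &
      forall xi, cube (rat_point q' p') tau' xi -> good_step Phi k q q' xi].
Proof.
move=> q0 cop tau0.
(* With 8 kappa = 1/(k+1), the three factors 1 + kappa, 1 - kappa and
   1 - 2 kappa together cost less than 1/(k+1). *)
have [kappa [kE kappa0 kappa1]] : exists kappa : R,
    [/\ k.+1%:R^-1 = 8 * kappa, 0 < kappa & 8 * kappa <= 1].
  have k10 : 0 < (k.+1%:R^-1 : R) by rewrite invr_gt0 ltr0n.
  have k11 : (k.+1%:R^-1 : R) <= 1 by rewrite invf_le1 ?ltr0n ?ler1n.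
  exists (k.+1%:R^-1 / 8); move: (k.+1%:R^-1) k10 k11 => x x0 x1.
  by split; lra.
have kappaI : 0 < kappa <= 1 by rewrite kappa0 /=; lra.
have [G1 hG1] := natr_ge (2 / tau).
have [G2 hG2] := natr_ge (q%:R / kappa).
pose G3 := (2 * k.+1 * q ^ k)%N.
have [h [C [L [[qh qC /andP[GC Ch] C0] /andP[qq' q'L] PhiQ PhiL PhiL']]]] :=
  approximation_parameters Phi01 (G1 + G2 + G3) h1 h2 h3 q0 kappaI kappa0.
have [G1h G2C G3h] : [/\ G1 <= h, G2 <= C & G3 <= h]%N.
  split; last 1 first.
  - by rewrite (leq_trans _ Ch)// (leq_trans _ GC)// leq_addl.
  - by rewrite (leq_trans _ Ch)// (leq_trans _ GC)// -addnA leq_addr.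
  - by rewrite (leq_trans _ GC)// addnAC leq_addl.
have h0 : (0 < h)%N := leq_trans C0 Ch.
have h0R : 0 < (h%:R : R) by rewrite ltr0n.
have C0R : 0 < (C%:R : R) by rewrite ltr0n.
have q0R : 0 < (q%:R : R) by rewrite ltr0n.
have qCk : q%:R / C%:R <= kappa.
  rewrite ler_pdivrMr// mulrC -ler_pdivrMr//.
  by apply: le_trans hG2 _; rewrite ler_nat.
have htau : 2 / h%:R <= tau.
  rewrite ler_pdivrMr// mulrC -ler_pdivrMr//.
  by apply: le_trans hG1 _; rewrite ler_nat.
set q' := (C * h ^ m.+1)%N in qq' q'L PhiL' *.
have q'0R : 0 < (q'%:R : R) by rewrite ltr0n (leq_trans _ qq').
pose tau' : R := kappa / h%:R / q'%:R.
have tau'0 : 0 < tau' by rewrite /tau' !divr_gt0.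
pose w : 'rV[R]_m.+2 := rat_point q' (shift_num q h C p).
have nearby n : (n <= q')%N -> n%:R * tau' <= kappa / h%:R.
  move=> nq'; rewrite /tau' mulrA ler_pdivrMr// mulrC.
  by rewrite ler_pM2l ?divr_gt0// ler_nat.
have tau'h : tau' <= h%:R^-1.
  have := nearby 1%N (leq_trans q0 (ltnW qq')); rewrite mul1r => /le_trans; apply.
  by rewrite ler_pdivrMr// mulVf ?gt_eqF//; lra.
have wp i : `|w ord0 i - (p ord0 i)%:~R / q%:R| <= (q * h)%:R^-1.
  rewrite rat_point_shift// addrC addKr ger0_norm ?invr_ge0//.
  rewrite lef_pV2 ?posrE ?ler_nat ?shift_den_ge// ltr0n ?muln_gt0 ?q0//.
  by rewrite (leq_trans _ (shift_den_ge C0 Ch qC _))// muln_gt0 q0.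
exists q', (shift_num q h C p), tau'; split => //.
  move=> xi xiw i; rewrite [in leLHS]mxE.
  apply: le_trans (ler_distD (w ord0 i) _ _) _.
  apply: le_trans (lerD (xiw i) (wp i)) _; apply: le_trans htau.
  rewrite (_ : 2 / h%:R = h%:R^-1 + h%:R^-1) ?lerD//; last first.
    by rewrite mulr_natl mulr2n.
  by rewrite lef_pV2 ?posrE ?ler_nat ?ltr0n ?muln_gt0 ?q0// leq_pmull.
move=> xi xiw.
have dq : dist_int_vec (q%:R *: xi) <= (1 + kappa) / h%:R.
  apply: dist_int_vec_le; first by rewrite divr_ge0// addr_ge0 ?ler01 ?ltW.
  move=> i; exists (p ord0 i); rewrite !mxE.
  have -> : q%:R * xi ord0 i - (p ord0 i)%:~R
      = q%:R * (xi ord0 i - w ord0 i + (w ord0 i - (p ord0 i)%:~R / q%:R)).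
    by field; rewrite gt_eqF.
  rewrite normrM (ger0_norm (ltW q0R)).
  apply: (@le_trans _ _ (q%:R * (tau' + (q * h)%:R^-1))).
    by rewrite ler_pM2l// (le_trans (ler_normD _ _))// lerD.
  rewrite mulrDr mulrDl addrC lerD// ?nearby ?(ltnW qq')//.
  by rewrite natrM invfM mulrA divff ?mul1r ?gt_eqF.
have psi_q Q : (q <= Q)%N -> psi xi Q%:R <= (1 + kappa) / h%:R.
  by move=> qQ; apply: le_trans dq; apply: psi_le; rewrite ?ler_nat.
split.
- move=> Q /andP[qQ Qq']; apply: le_lt_trans (psi_q Q qQ) _.
  by apply: PhiQ; rewrite qQ (leq_trans Qq').
- have qQ : (q <= q'.-1)%N by rewrite -ltnS prednK// (leq_trans _ qq').
  exists q'.-1 => //.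
  apply: (@lt_le_trans _ _ ((1 - 2 * kappa) / h%:R)).
    have k1 : 0 < 1 - kappa by lra.
    rewrite -(ltr_pM2l k1) mulrCA.
    rewrite kE.
    apply: (@le_lt_trans _ _ ((1 - 8 * kappa) * ((1 + kappa) / h%:R))).
      by rewrite ler_wpM2l ?(le_trans PhiL')//; lra.
    by rewrite !mulrA ltr_pM2r ?invr_gt0//; nra.
  apply: psi_ge; first by rewrite ler1n (leq_trans q0).
  move=> n n0; rewrite ler_nat => nq'; rewrite leNgt; apply/negP => nearv.
  have nq : (n < q')%N by rewrite (leq_ltn_trans nq')// ltn_predL (leq_trans _ qq').
  (* All coordinates of n w would be close to integers, so q' would divide n. *)
  suff : (q'%:Z %| n%:Z)%Z.
    by rewrite dvdzE /= => /(dvdn_leq n0); rewrite leqNgt nq.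
  apply: (@shift_separation R m q h C p) => // i.
  have [z hz] := dist_int_lt (le_lt_trans (le_dist_int_vec (n%:R *: xi) i) nearv).
  exists z; rewrite -pmulrn -/w.
  have -> : n%:R * w ord0 i - z%:~R
     = ((n%:R *: xi) ord0 i - z%:~R) - n%:R * (xi ord0 i - w ord0 i).
    by rewrite !mxE; ring.
  apply: le_lt_trans (ler_normB _ _) _.
  apply: (@lt_le_trans _ _ ((1 - 2 * kappa) / h%:R + kappa / h%:R)).
    apply: ltr_leD => //; rewrite normrM ger0_norm//.
    apply: le_trans (nearby n (ltnW nq)).
    by apply: ler_wpM2l => //; exact: xiw.
  rewrite -mulrDl [leRHS]mulrC ler_pM2r ?invr_gt0//; lra.
- apply: (@le_trans _ _ (q%:R ^+ k * ((1 + kappa) / h%:R))).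
    by rewrite ler_wpM2l ?exprn_ge0 ?psi_q.
  apply: (@le_trans _ _ (q%:R ^+ k * (2 / h%:R))).
    by rewrite ler_wpM2l ?exprn_ge0// ler_pM2r ?invr_gt0//; lra.
  rewrite mulrA ler_pdivrMr// mulrC ler_pdivlMl ?ltr0n//.
  by rewrite -natrX -!natrM ler_nat mulnA [(k.+1 * 2)%N]mulnC.
Qed.

End ExactStepExists.

(** * The tree and its dyadic children *)

Section Tree.
Context {R : realType} {m : nat}.
Variable Phi : nat -> R.
Hypotheses (Phi01 : maps_to_01 Phi) (h1 : cond_d1 m.+2 Phi)
  (h2 : cond_d2 m.+2 Phi) (h3 : cond_d3 m.+2 Phi).

(* The pair (q, p) stands for the rational point p/q. *)
Let state := (nat * 'rV[int]_m.+2)%type.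

Definition admissible (s : state) : Prop :=
  (0 < s.1)%N /\ coprimez (s.2 ord0 ord0) s.1%:Z.

Definition state_cube (s : state) : set 'rV[R]_m.+2 :=
  cube (rat_point s.1 s.2) (4 * s.1%:R)^-1.

Definition child (k : nat) (s s' : state) : Prop :=
  [/\ admissible s', (s.1 < s'.1)%N, state_cube s' `<=` state_cube s &
      forall xi, state_cube s' xi -> good_step Phi k s.1 s'.1 xi].

(** All numerators are odd, which makes them coprime to the denominator; the
    offset f selects a cube of such points and j a point in it. *)
Definition dyadic (e : nat) (f : 'I_m.+2 -> int) (j : 'I_m.+2 -> nat) : state :=
  ((2 ^ e)%N, \row_i (2 * (f i + (j i)%:Z) + 1)).

Lemma dyadic_admissible e f j : admissible (dyadic e f j).
Proof.
split; first by rewrite /= expn_gt0.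
rewrite /= mxE coprimezE coprimeXr// coprimen2.
set x := (f ord0 + _); lia.
Qed.

Lemma dyadic_separated e f (j j' : 'I_m.+2 -> nat) (x x' : 'rV[R]_m.+2) i :
  state_cube (dyadic e f j) x -> state_cube (dyadic e f j') x' ->
  j i != j' i -> (2 ^ e)%:R^-1 < `|x ord0 i - x' ord0 i|.
Proof.
move=> /(_ i) + /(_ i); rewrite !mxE /= => hx hx' jj'.
have e0 : 0 < ((2 ^ e)%:R : R) by rewrite ltr0n expn_gt0.
have jjR : 1 <= `|(j i)%:R - (j' i)%:R : R|.
  rewrite ![_%:R]pmulrn -intrB -intr_norm -[1]/(1%:~R) ler_int.
  by move: jj'; move: (j i) (j' i) => a b /eqP; lia.
have cE : (2 * (f i + (j i)%:Z) + 1)%:~R / (2 ^ e)%:R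
    - (2 * (f i + (j' i)%:Z) + 1)%:~R / (2 ^ e)%:R
    = 2 * ((j i)%:R - (j' i)%:R) / (2 ^ e)%:R :> R.
  rewrite !(intrD, intrM) -!pmulrn.
  by field; rewrite gt_eqF.
set c := _ / _ in hx cE; set c' := _ / _ in hx' cE.
have hc : 2 / (2 ^ e)%:R <= `|c - c'|.
  rewrite cE !normrM normfV (ger0_norm (ltW e0)) ler_pM2r ?invr_gt0//.
  by rewrite ger0_norm// -[leLHS]mulr1 ler_wpM2l.
rewrite invfM in hx hx'.
have tri : `|c - c'| <= `|x ord0 i - x' ord0 i| + `|x ord0 i - c|
    + `|x' ord0 i - c'|.
  rewrite (_ : c - c' = x ord0 i - x' ord0 i - (x ord0 i - c) + (x' ord0 i - c')).
    by rewrite (le_trans (ler_normD _ _))// lerD2r ler_normB.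
  by ring.
have r0 : 0 < ((2 ^ e)%:R^-1 : R) by rewrite invr_gt0.
lra.
Qed.

(** After an exact move to p'/q', the dyadic points within 2J/2^e of p'/q' form a
    grid of J points in each direction. They keep (C1) as long as
    2 J q'/2^e, which bounds the distance of q' xi from the integer points, is
    less than Phi. *)
Lemma dyadic_children (k : nat) (s : state) : admissible s ->
  exists (q' : nat) (tau : R), [/\ (0 < q')%N, 0 < tau &
    forall e J : nat, (0 < J)%N -> (q' < 2 ^ e)%N ->
      2 * J%:R / (2 ^ e)%:R <= tau ->
      (forall Q, (q' <= Q < 2 ^ e)%N ->
         2 * J%:R * q'%:R / (2 ^ e)%:R < Phi Q) ->
      exists f : 'I_m.+2 -> int, forall j : 'I_m.+2 -> nat,
        (forall i, (j i < J)%N) -> child k s (dyadic e f j)].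
Proof.
case: s => q p [/= q0 cop].
have r0 : 0 < (4 * q%:R : R)^-1 by rewrite invr_gt0 mulr_gt0// ltr0n.
have [q' [p' [tau' [qq' tau'0 sub good]]]] :=
  exact_step Phi01 h1 h2 h3 k q0 cop r0.
have q'0 : (0 < q')%N := leq_trans q0 (ltnW qq').
exists q', tau'; split => // e J J0 q'e Je PhiQ.
have e0 : 0 < ((2 ^ e)%:R : R) by rewrite ltr0n expn_gt0.
pose w : 'rV[R]_m.+2 := rat_point q' p'.
(* With x = 2^e w_i / 2 and 0 <= j < J, the odd number 2 (floor x + j) + 1 is
   within 2J - 1 of 2x; the remaining 1/2^e absorbs the radius of the cube. *)
exists (fun i => Num.floor ((2 ^ e)%:R * w ord0 i / 2)) => j jJ.
set s' := dyadic _ _ _.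
have near_w xi : state_cube s' xi ->
    forall i, `|xi ord0 i - w ord0 i| <= 2 * J%:R / (2 ^ e)%:R.
  move=> xis i; have := xis i; rewrite mxE [s'.1]/= [s'.2 _ _]mxE.
  set x := (2 ^ e)%:R * w ord0 i / 2.
  have wE : w ord0 i = 2 * x / (2 ^ e)%:R by rewrite /x; field; rewrite gt_eqF.
  have := floor_itv x; set fl := Num.floor x => /andP[fl1 fl2].
  rewrite intrD in fl2.
  rewrite invfM wE => hx.
  have jR : (j i)%:R + 1 <= J%:R :> R by rewrite natr1 ler_nat.
  have j0 : 0 <= (j i)%:R :> R by [].
  have hw : `|(2 * (fl + (j i)%:Z) + 1)%:~R / (2 ^ e)%:R - 2 * x / (2 ^ e)%:R|
      <= (2 * J%:R - 1) / (2 ^ e)%:R :> R.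
    rewrite -mulrBl normrM normfV (ger0_norm (ltW e0)) ler_pM2r ?invr_gt0//.
    by rewrite !(intrD, intrM) -!pmulrn ler_norml; apply/andP; split; lra.
  apply: le_trans (ler_distD _ _ _) _; apply: le_trans (lerD hx hw) _.
  by rewrite -mulrDl ler_pM2r ?invr_gt0//; lra.
have sub' : state_cube s' `<=` cube w tau'.
  by move=> xi /near_w xiw i; exact: le_trans (xiw i) Je.
split.
- exact: dyadic_admissible.
- exact: ltn_trans qq' q'e.
- exact: subset_trans sub' sub.
move=> xi xis; have [psi_lt C2 C3] := good xi (sub' _ xis); split => //.
move=> Q /andP[qQ Qe]; have [Qq'|q'Q] := ltnP Q q'.
  by apply: psi_lt; rewrite qQ.
apply: le_lt_trans (PhiQ Q _); last by rewrite q'Q.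
apply: (@le_trans _ _ (dist_int_vec (q'%:R *: xi))).
  by apply: psi_le; rewrite ?ler_nat.
apply: dist_int_vec_le; first by rewrite !mulr_ge0// invr_ge0.
move=> i; exists (p' ord0 i).
have -> : (q'%:R *: xi) ord0 i - (p' ord0 i)%:~R = (xi ord0 i - w ord0 i) * q'%:R.
  by rewrite !mxE; field; rewrite pnatr_eq0 -lt0n.
rewrite normrM [X in _ * X]ger0_norm// mulrAC ler_pM2r ?ltr0n//.
exact: near_w.
Qed.

Lemma branch_solution (u : nat -> state) : (forall k, admissible (u k)) ->
  (forall k, child k (u k) (u k.+1)) ->
  exists2 xi, solutions Phi xi & forall k, state_cube (u k) xi.
Proof.
move=> adm chain.
have [k|k|xi xiP] := @nested_cubes R m.+2 (fun k => rat_point (u k).1 (u k).2)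
    (fun k => (4 * (u k).1%:R)^-1).
- by rewrite invr_ge0 mulr_ge0.
- by have [] := chain k.
exists xi => //; apply: (solutions_of_good_steps Phi01 (q := fun k => (u k).1)).
- by have [] := adm 0%N.
- by move=> k; have [] := chain k.
- by move=> k; have [_ _ _] := chain k; apply; exact: (xiP k.+1).
Qed.

Lemma solutions_category (E : nat -> set 'rV[R]_m.+2) :
  solutions Phi `<=` \bigcup_i E i ->
  exists k s, admissible s /\
    forall s', child k s s' -> state_cube s' `&` E k !=set0.
Proof.
apply: (@tree_category _ _ admissible child state_cube _ _ (1%N, 0)).
- by split=> //=; rewrite coprimezE coprimen1.
- by move=> k s s' [].
- exact: branch_solution.
Qed.

(** Condition (d2) makes Phi Q at least M/Q for large Q, as the exponent
    1/(m+1) is at most 1; this leaves room for any bounded number of dyadic children. *)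
Lemma Phi_gt_div_expn2 (M : R) : 0 < M -> exists e0, forall e, (e0 <= e)%N ->
  forall Q, (0 < Q < 2 ^ e)%N -> M / (2 ^ e)%:R < Phi Q.
Proof.
move=> M0.
have [T hT] := cond_d2_ge M h2.
have [c c0 cP] := Phi_pos_min Phi01 T.
have [e0 he0] := div_expn2_small M c0.
exists e0 => e /he0 Mc Q /andP[Q0 Qe].
have e_gt0 : 0 < ((2 ^ e)%:R : R) by rewrite ltr0n expn_gt0.
have [QT|TQ] := ltnP Q T.
  by apply: le_lt_trans Mc _; rewrite cP ?Q0.
have Q0R : 0 < (Q%:R : R) by rewrite ltr0n.
apply: (@lt_le_trans _ _ (M / Q%:R)).
  by rewrite ltr_pM2l// ltf_pV2 ?posrE// ltr_nat.
rewrite ler_pdivrMr// mulrC; apply: le_trans (hT Q TQ) _.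
rewrite ler_pM2r ?(Phi_gt0 Phi01)//.
rewrite -[leRHS]powRr1 ?ler0n//; apply: ler_powR; first by rewrite ler1n.
by rewrite invf_le1 ?ltr0n// ler1n.
Qed.

(** An injection of the solutions into nat cuts them into pieces with at most one
    point, but two children of a node have disjoint cubes. *)
Lemma solutions_uncountable : ~ countable (solutions (m := m.+2) Phi).
Proof.
move=> /countable_injP[f finj].
have [k [s [sP meets]]] : exists k s, admissible s /\ forall s', child k s s' ->
    state_cube s' `&` [set x | solutions Phi x /\ f x = k] !=set0.
  apply: (solutions_category
    (E := fun i => [set x | solutions Phi x /\ f x = i])).
  by move=> x xP; exists (f x).
have [q' [tau [q'0 tau0 kids]]] := dyadic_children k sP.
have [e1 he1] := expn2_gt q'.
have [e2 he2] := div_expn2_small (2 * 2) tau0.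
have M0 : 0 < 2 * 2 * q'%:R :> R by rewrite !mulr_gt0// ltr0n.
have [e3 he3] := Phi_gt_div_expn2 M0.
pose e := maxn e1 (maxn e2 e3).
have [g hg] : exists g, forall j, (forall i, (j i < 2)%N) ->
    child k s (dyadic e g j).
  apply: kids => //.
  - by apply: he1; rewrite leq_maxl.
  - by apply: he2; rewrite !leq_max leqnn orbT.
  - move=> Q /andP[q'Q Qe]; apply: he3; first by rewrite !leq_max leqnn !orbT.
    by rewrite (leq_trans q'0).
have [x [xs [xsol fx]]] := meets _ (hg (fun=> 0%N) (fun=> isT)).
have [y [ys [ysol fy]]] := meets _ (hg (fun=> 1%N) (fun=> isT)).
have xy : x = y by apply: finj; rewrite ?inE// fx fy.
have := dyadic_separated (i := ord0) xs ys isT.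
by rewrite xy subrr normr0 ltNge invr_ge0 ler0n.
Qed.

End Tree.

(** * The packing dimension *)

Section PackingBound.
Context {R : realType} {m : nat}.
Variable Phi : nat -> R.
Hypotheses (Phi01 : maps_to_01 Phi) (h1 : cond_d1 m.+2 Phi)
  (h2 : cond_d2 m.+2 Phi) (h3 : cond_d3 m.+2 Phi).

(** Suppose s < (m+2) (1 - gamma) and the solutions are null for the exponent s.
    Some piece E_k of finite premeasure meets all the children of a node. With
    T = 2^e and J close to K T^(1 - gamma), where K depends on the node only,
    (d4) admits J^(m+2) dyadic children, which give as many points of E_k at
    mutual distance more than 1/T; and J^(m+2) T^-s is at least a constant times
    T^((m+2) (1 - gamma) - s), which is unbounded. *)
Lemma packing_dim_solutions_ge (gamma : R) : 0 < gamma -> cond_d4 gamma Phi ->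
  ((m.+2%:R * (1 - gamma))%:E <= packing_dim (solutions (m := m.+2) Phi))%E.
Proof.
move=> gamma0 [eta [t0 [eta0 d4]]].
apply: le_ereal_inf_tmp => _ [s [s0 Ps0] <-]; rewrite lee_fin leNgt.
apply/negP => s_lt.
have [E FE Efin] := packing_measure0_cover Ps0.
have [k [st [stP meets]]] := solutions_category Phi01 FE.
suff Einf : packing_premeasure s (E k) = +oo%E by have := Efin k; rewrite Einf.
have [q' [tau [q'0 tau0 kids]]] := dyadic_children Phi01 h1 h2 h3 k stP.
have q'0R : 0 < (q'%:R : R) by rewrite ltr0n.
have gamma1 : 0 < 1 - gamma.
  rewrite -(pmulr_rgt0 _ (_ : 0 < m.+2%:R :> R)) ?ltr0n//.
  exact: le_lt_trans s_lt.
pose K : R := eta / (2 * q'%:R).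
have K0 : 0 < K by rewrite /K divr_gt0// mulr_gt0.
have [c c0 cP] := Phi_pos_min Phi01 t0.
apply: packing_premeasure_pinfty => M r0 r00.
have a0 : 0 < m.+2%:R * (1 - gamma) - s by rewrite subr_gt0.
have [e1 he1] := expn2_gt q'.
have [e2 he2] := div_expn2_small 1 r00.
have [e3 he3] := powR_expn2_large K^-1 gamma1.
have [e4 he4] := powR_expn2_large (eta / q'%:R / tau) gamma0.
have [e5 he5] := powR_expn2_large (2 * eta / c) gamma0.
have [e6 he6] := powR_expn2_large (M / (K / 2) ^+ m.+2) a0.
have [e [le1 le2 le3 [le4 le5 le6]]] : exists e,
    [/\ e1 <= e, e2 <= e, e3 <= e & [/\ e4 <= e, e5 <= e & e6 <= e]]%N.
  exists (\max_(i <- [:: e1; e2; e3; e4; e5; e6]) i).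
  by split; try split; apply: leq_bigmax_seq; rewrite ?inE ?eqxx ?orbT.
have {}he1 := he1 e le1; have {}he2 := he2 e le2; have {}he3 := he3 e le3.
have {}he4 := he4 e le4; have {}he5 := he5 e le5; have {}he6 := he6 e le6.
have e_gt0 : 0 < ((2 ^ e)%:R : R) by rewrite ltr0n expn_gt0.
set T : R := (2 ^ e)%:R in he2 he3 he4 he5 he6 e_gt0.
have Tg0 : 0 < T `^ gamma by rewrite powR_gt0.
have TE : T `^ (1 - gamma) = T / T `^ gamma.
  by rewrite powRB ?powRr1 ?ltW// (lt0r_neq0 e_gt0) implybT.
have [J [J0 JK KJ]] : exists J : nat, [/\ (0 < J)%N,
    J%:R <= K * T `^ (1 - gamma) & K * T `^ (1 - gamma) / 2 <= J%:R].
  by apply: truncn_ge_half; rewrite mulrC -ler_pdivrMr// mul1r.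
have KTE : K * T `^ (1 - gamma) * (2 * q'%:R) / T = eta / T `^ gamma.
  by rewrite TE /K; field; rewrite !gt_eqF.
have JT : 2 * J%:R * q'%:R / T <= eta / T `^ gamma.
  rewrite -KTE ler_pM2r ?invr_gt0// (_ : 2 * J%:R * q'%:R = J%:R * (2 * q'%:R)).
    by rewrite ler_pM2r// mulr_gt0.
  by ring.
have [f kidsP] : exists f, forall j, (forall i, (j i < J)%N) ->
    child Phi k st (dyadic e f j).
  apply: kids => //.
  - rewrite -(ler_pM2r q'0R) mulrAC; apply: le_trans JT _.
    rewrite ler_pdivrMr//; move: he4; rewrite ler_pdivrMr// ler_pdivrMr//.
    by congr (_ <= _); ring.
  - move=> Q /andP[q'Q Qe]; apply: le_lt_trans JT _.
    have Q0 : (0 < Q)%N := leq_trans q'0 q'Q.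
    have Q0R : 0 < (Q%:R : R) by rewrite ltr0n.
    have [Qt0|t0Q] := ltnP Q t0.
      apply: lt_trans (cP Q _); last by rewrite Q0.
      rewrite ltr_pdivrMr// mulrC -ltr_pdivrMr//.
      apply: lt_le_trans he5; rewrite -mulrA mulr_natl mulr2n ltrDl.
      by rewrite divr_gt0.
    apply: le_lt_trans (d4 Q t0Q).
    rewrite powRN ler_pM2l// lef_pV2 ?posrE ?powR_gt0//.
    by apply: ge0_ler_powR; rewrite ?nnegrE ?ltW// ltr_nat.
have pick (j : {ffun 'I_m.+2 -> 'I_J}) : exists x,
    state_cube (dyadic e f (fun i => j i)) x /\ E k x.
  have [x [xs xE]] := meets _ (kidsP (fun i => j i) (fun i => ltn_ord (j i))).
  by exists x.
have [x xP] := choice pick.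
(* Radius 1/(2T): the points are more than 1/T apart. *)
exists (2 * T)^-1, {ffun 'I_m.+2 -> 'I_J}, x; split.
- rewrite invr_gt0 mulr_gt0//=; apply: le_trans he2.
  by rewrite mul1r lef_pV2 ?posrE ?mulr_gt0// mulr_natl mulr2n lerDl ltW.
- by move=> j; have [] := xP j.
- move=> j j' jj'; have [i ji] : exists i, j i != j' i.
    apply/existsP; rewrite -negb_forall; apply: contra jj' => /forallP jE.
    by apply/eqP/ffunP => i; apply/eqP.
  have := dyadic_separated (xP j).1 (xP j').1 (i := i) ji.
  rewrite invfM mulrA divff// mul1r => /lt_le_trans; apply.
  have := coord_le_norm (x j - x j') i.
  by rewrite !mxE.
rewrite card_ffun !card_ord natrX invfM mulrA divff// mul1r.
have -> : T^-1 `^ s = T `^ (- s) by rewrite -powR_inv1 ?ltW// -powRrM mulN1r.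
apply: (@le_trans _ _ ((K * T `^ (1 - gamma) / 2) ^+ m.+2 * T `^ (- s))); last first.
  rewrite ler_wpM2r ?powR_ge0// lerXn2r// ?nnegrE//.
  by rewrite divr_ge0// mulr_ge0 ?powR_ge0// ltW.
rewrite [K * _ / 2]mulrAC exprMn -mulrA -(powR_mulrn _ (powR_ge0 T _)) -powRrM -powRD.
  have K20 : 0 < (K / 2) ^+ m.+2 by rewrite exprn_gt0// divr_gt0.
  by rewrite [_ * m.+2%:R]mulrC [leRHS]mulrC -ler_pdivrMr.
by rewrite (lt0r_neq0 e_gt0) implybT.
Qed.

End PackingBound.

Theorem theorem2p2 (R : realType) (m : nat) (Phi : nat -> R)
  (hm : (2 <= m)%N) (hPhi : maps_to_01 Phi)
  (h1 : cond_d1 m Phi) (h2 : cond_d2 m Phi) (h3 : cond_d3 m Phi) :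
  ~ countable (solutions (m := m) Phi) /\
  (forall gamma : R, 0 < gamma -> cond_d4 gamma Phi ->
     ((m%:R * (1 - gamma))%:E <= packing_dim (solutions (m := m) Phi))%E).
Proof.
case: m hm h1 h2 h3 => [//|[//|m]] _ h1 h2 h3; split.
  exact: solutions_uncountable.
by move=> gamma; exact: packing_dim_solutions_ge.
Qed.
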